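(* Let $n$ be an odd number. Then, for every $x\in\mathbb{R}^{n+1}$, we have $$\Delta_{\mathbb{R}^{n+1}}^{\frac{n-1}{2}}(e^x)=\gamma_n\sum_{k=0}^\infty\frac{P_k^n(x)}{k!},$$ $$\Delta_{\mathbb{R}^{n+1}}^{\frac{n-1}{2}}(\sinh(x))=\gamma_n\sum_{k=0}^\infty\frac{P_{2k+1}^n(x)}{(2k+1)!},\qquad \Delta_{\mathbb{R}^{n+1}}^{\frac{n-1}{2}}(\cosh(x))=\gamma_n\sum_{k=0}^\infty\frac{P_{2k}^n(x)}{(2k)!},$$ $$\Delta_{\mathbb{R}^{n+1}}^{\frac{n-1}{2}}(\cos(x))=\gamma_n\sum_{k=0}^\infty\frac{(-1)^k}{(2k)!}P_{2k}^n(x),\qquad \Delta_{\mathbb{R}^{n+1}}^{\frac{n-1}{2}}(\sin(x))=\gamma_n\sum_{k=0}^\infty\frac{(-1)^k}{(2k+1)!}P_{2k+1}^n(x),$$ where $\gamma_n:=\frac{(-1)^{\frac{n-1}{2}}2^{n-1}}{(n-1)!}\left[\Gamma\left(\frac{n+1}{2}\right)\right]^2$.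
   Context: $\mathbb{R}_n$ is the real Clifford algebra generated by $e_1,\dots,e_n$ with $e_\ell e_m+e_me_\ell=0$ for $\ell\ne m$ and $e_\ell^2=-1$. A point $(x_0,\dots,x_n)\in\mathbb{R}^{n+1}$ is identified with the paravector $x=x_0+\underline{x}$, $\underline{x}=\sum_{\ell=1}^n x_\ell e_\ell$; $\bar x=x_0-\underline{x}$. $\Delta_{\mathbb{R}^{n+1}}=\sum_{i=0}^n\partial_{x_i}^2$ is the Laplacian and $\Delta_{\mathbb{R}^{n+1}}^{(n-1)/2}$ its $\frac{n-1}{2}$-th iterate. For $x\in\mathbb{R}^{n+1}$ the functions are defined by the power series in $\mathbb{R}_n$: $e^x=\sum_{k\ge0}\frac{x^k}{k!}$, $\sinh(x)=\sum_{k\ge0}\frac{x^{2k+1}}{(2k+1)!}$, $\cosh(x)=\sum_{k\ge0}\frac{x^{2k}}{(2k)!}$, $\sin(x)=\sum_{k\ge0}\frac{(-1)^k}{(2k+1)!}x^{2k+1}$, $\cos(x)=\sum_{k\ge0}\frac{(-1)^k}{(2k)!}x^{2k}$. The Clifford-Appell polynomials are $$P_k^n(x):=\sum_{s=0}^k T_s^k(n)\,x^{k-s}\bar x^{s},\qquad T_s^k(n):=\binom{k}{s}\frac{\left(\frac{n+1}{2}\right)_{k-s}\left(\frac{n-1}{2}\right)_s}{(n)_k},$$ where $(a)_0=1$ and $(a)_s=a(a+1)\cdots(a+s-1)$ for $s>0$. $\Gamma$ is the Gamma function.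
   Formalization: The cos and sin identities are proved with an extra factor (-1)^((n-1)/2) in front of γ_n; as printed they are false for n ≡ 3 mod 4 (n=3, x=0: Δcos = 2, but γ_3 P_0 = -2). For n ≡ 1 mod 4 the printed formulas are unchanged. *)

(* Defs.v *)
From HB Require Import structures.
From mathcomp Require Import all_boot all_order all_algebra.
From mathcomp Require Import all_classical all_reals all_analysis.

Set Implicit Arguments.
Unset Strict Implicit.
Unset Printing Implicit Defensive.

Import Order.TTheory GRing.Theory Num.Theory.
Import numFieldNormedType.Exports.

Local Open Scope classical_set_scope.
Local Open Scope ring_scope.

(* The Clifford algebra R_n as the space of coordinate vectors on the blades
   e_A = e_(i_1) ... e_(i_r), A = {i_1 < ... < i_r}, with A ranging over the
   2^n subsets of 'I_n; the generators e_1, ..., e_n are indexed from 0.  The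
   sup norm inherited from row vectors gives the usual topology. *)
Definition clifford (R : realType) (n : nat) : Type :=
  'rV[R]_#|{: {set 'I_n}}|.

HB.instance Definition _ (R : realType) (n : nat) :=
  NormedModule.copy (clifford R n) 'rV[R]_#|{: {set 'I_n}}|.

HB.instance Definition _ (R : realType) (n : nat) :=
  Complete.copy (clifford R n) 'rV[R]_#|{: {set 'I_n}}|.

Section CliffordRing.
Context {R : realType} {n : nat}.
Implicit Types (A B C : {set 'I_n}) (a b c : clifford R n).

Definition cliff_coord A a : R := (a : 'rV[R]__) ord0 (enum_rank A).

Definition blade A : clifford R n := delta_mx ord0 (enum_rank A).

Definition symdiff A B : {set 'I_n} := (A :\: B) :|: (B :\: A).

(* e_A e_B = blade_sign A B *: e_(symdiff A B): moving e_j (j in B) leftwards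
   past each e_i (i in A, j < i) changes the sign, and i = j gives e_i^2 = -1. *)
Definition blade_sign A B : R :=
  \prod_(i in A) \prod_(j in B | (j <= i)%N) (-1).

Definition cliff_mul a b : clifford R n :=
  \sum_A \sum_B
    (cliff_coord A a * cliff_coord B b * blade_sign A B) *: blade (symdiff A B).

Lemma symdiffA : associative symdiff.
Proof.
move=> A B C; apply/setP => i; rewrite !inE.
by case: (i \in A); case: (i \in B); case: (i \in C).
Qed.

Lemma sym0diff : left_id finset.set0 symdiff.
Proof. by move=> A; apply/setP => i; rewrite !inE; case: (i \in A). Qed.

Lemma symdiff0 : right_id finset.set0 symdiff.
Proof. by move=> A; apply/setP => i; rewrite !inE; case: (i \in A). Qed.

Lemma blade_signDl A B C :
  blade_sign (symdiff A B) C = blade_sign A C * blade_sign B C.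
Proof.
rewrite /blade_sign big_mkcond [in RHS]big_mkcond.
rewrite [X in _ = _ * X]big_mkcond -big_split /=; apply: eq_bigr => i _.
rewrite !inE; case: (i \in A); case: (i \in B); rewrite /= ?mulr1 ?mul1r //.
by rewrite -big_split /= big1 // => j _; rewrite mulrNN mulr1.
Qed.

Lemma blade_signDr A B C :
  blade_sign A (symdiff B C) = blade_sign A B * blade_sign A C.
Proof.
rewrite /blade_sign -big_split /=; apply: eq_bigr => i _.
rewrite big_mkcond [in RHS]big_mkcond.
rewrite [X in _ = _ * X]big_mkcond -big_split /=; apply: eq_bigr => j _.
rewrite !inE; case: (j \in B); case: (j \in C); case: (j <= i)%N;
  by rewrite /= ?mulrNN ?mulr1 ?mul1r.
Qed.

Lemma blade_sign0l A : blade_sign finset.set0 A = 1.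
Proof. by rewrite /blade_sign big1 // => i; rewrite inE. Qed.

Lemma blade_sign0r A : blade_sign A finset.set0 = 1.
Proof.
by rewrite /blade_sign big1 // => i _; rewrite big1 // => j; rewrite inE.
Qed.

Lemma cliff_coordD A a b : cliff_coord A (a + b) = cliff_coord A a + cliff_coord A b.
Proof. by rewrite /cliff_coord mxE. Qed.

Lemma cliff_coordZ A (r : R) a : cliff_coord A (r *: a) = r * cliff_coord A a.
Proof. by rewrite /cliff_coord mxE. Qed.

Lemma cliff_coord_blade A B : cliff_coord A (blade B) = (A == B)%:R.
Proof. by rewrite /cliff_coord mxE eqxx (inj_eq enum_rank_inj). Qed.

Lemma cliff_coordE a : a = \sum_A cliff_coord A a *: blade A.
Proof.
rewrite {1}(row_sum_delta a).
rewrite (reindex (@enum_rank {set 'I_n})) //=.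
by exists (@enum_val {set 'I_n} predT) => x _; rewrite ?enum_rankK ?enum_valK.
Qed.

Lemma cliff_mulDl : left_distributive cliff_mul +%R.
Proof.
move=> a b c; rewrite /cliff_mul -big_split; apply: eq_bigr => A _ /=.
rewrite -big_split; apply: eq_bigr => B _ /=.
by rewrite cliff_coordD !mulrDl scalerDl.
Qed.

Lemma cliff_mulDr : right_distributive cliff_mul +%R.
Proof.
move=> a b c; rewrite /cliff_mul -big_split; apply: eq_bigr => A _ /=.
rewrite -big_split; apply: eq_bigr => B _ /=.
by rewrite cliff_coordD !(mulrDl, mulrDr) scalerDl.
Qed.

Lemma cliff_mulZl (r : R) a b : r *: cliff_mul a b = cliff_mul (r *: a) b.
Proof.
rewrite /cliff_mul scaler_sumr; apply: eq_bigr => A _.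
rewrite scaler_sumr; apply: eq_bigr => B _.
by rewrite cliff_coordZ scalerA !mulrA.
Qed.

Lemma cliff_mulZr (r : R) a b : r *: cliff_mul a b = cliff_mul a (r *: b).
Proof.
rewrite /cliff_mul scaler_sumr; apply: eq_bigr => A _.
rewrite scaler_sumr; apply: eq_bigr => B _.
by rewrite cliff_coordZ scalerA !mulrA [r * _]mulrC.
Qed.

Lemma cliff_mul0l b : cliff_mul 0 b = 0.
Proof. by rewrite -(scale0r (0 : clifford R n)) -cliff_mulZl !scale0r. Qed.

Lemma cliff_mul0r b : cliff_mul b 0 = 0.
Proof. by rewrite -(scale0r (0 : clifford R n)) -cliff_mulZr !scale0r. Qed.

Lemma cliff_mul_suml (I : Type) (r : seq I) (F : I -> clifford R n) b :
  cliff_mul (\sum_(i <- r) F i) b = \sum_(i <- r) cliff_mul (F i) b.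
Proof.
exact: (big_morph (cliff_mul^~ b) (fun x y => cliff_mulDl x y b) (cliff_mul0l b)).
Qed.

Lemma cliff_mul_sumr (I : Type) (r : seq I) (F : I -> clifford R n) b :
  cliff_mul b (\sum_(i <- r) F i) = \sum_(i <- r) cliff_mul b (F i).
Proof. exact: (big_morph (cliff_mul b) (cliff_mulDr b) (cliff_mul0r b)). Qed.

Lemma cliff_mul_blade A B :
  cliff_mul (blade A) (blade B) = blade_sign A B *: blade (symdiff A B).
Proof.
rewrite /cliff_mul (bigD1 A) //= [X in _ + X]big1 ?addr0; last first.
  move=> C CA; rewrite big1 // => D _.
  by rewrite cliff_coord_blade (negbTE CA) !mul0r scale0r.
rewrite (bigD1 B) //= big1 ?addr0; last first.
  by move=> C CB; rewrite !cliff_coord_blade (negbTE CB) mulr0 mul0r scale0r.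
by rewrite !cliff_coord_blade !eqxx !mul1r.
Qed.

Lemma cliff_mulA : associative cliff_mul.
Proof.
have Sl (F : {set 'I_n} -> clifford R n) b :=
  cliff_mul_suml (index_enum {set 'I_n}) F b.
have Sr (F : {set 'I_n} -> clifford R n) b :=
  cliff_mul_sumr (index_enum {set 'I_n}) F b.
move: Sl Sr cliff_mulZl cliff_mulZr cliff_mul_blade.
move: cliff_mul => mul Sl Sr Zl Zr mulE a b c.
rewrite (cliff_coordE a) !Sl.
apply: eq_bigr => A _; rewrite -!Zl; congr (_ *: _).
rewrite (cliff_coordE b) !(Sl, Sr).
apply: eq_bigr => B _; rewrite -Zl -!Zr -Zl; congr (_ *: _).
rewrite (cliff_coordE c) !Sr.
apply: eq_bigr => C _; rewrite -!Zr; congr (_ *: _).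
rewrite !mulE -Zr -Zl !mulE !scalerA symdiffA blade_signDl blade_signDr.
by rewrite mulrC -mulrA.
Qed.

Lemma cliff_mul1l : left_id (blade finset.set0) cliff_mul.
Proof.
move=> a; rewrite [in RHS](cliff_coordE a) {1}(cliff_coordE a) cliff_mul_sumr.
apply: eq_bigr => A _; rewrite -cliff_mulZr cliff_mul_blade.
by rewrite sym0diff blade_sign0l scale1r.
Qed.

Lemma cliff_mul1r : right_id (blade finset.set0) cliff_mul.
Proof.
move=> a; rewrite [in RHS](cliff_coordE a) {1}(cliff_coordE a) cliff_mul_suml.
apply: eq_bigr => A _; rewrite -cliff_mulZl cliff_mul_blade.
by rewrite symdiff0 blade_sign0r scale1r.
Qed.

Lemma blade0_neq0 : blade finset.set0 != 0.
Proof.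
apply/eqP => /(congr1 (cliff_coord finset.set0)).
by rewrite cliff_coord_blade eqxx /cliff_coord mxE => /eqP; rewrite oner_eq0.
Qed.

End CliffordRing.

HB.instance Definition _ (R : realType) (n : nat) :=
  GRing.Zmodule_isNzRing.Build (clifford R n)
    cliff_mulA cliff_mul1l cliff_mul1r cliff_mulDl cliff_mulDr blade0_neq0.

HB.instance Definition _ (R : realType) (n : nat) :=
  GRing.Lmodule_isLalgebra.Build R (clifford R n) cliff_mulZl.

HB.instance Definition _ (R : realType) (n : nat) :=
  GRing.Lalgebra_isAlgebra.Build R (clifford R n) cliff_mulZr.

Section CliffordFacts.
Context {R : realType} {n : nat}.

Definition cliff_gen (l : 'I_n) : clifford R n := blade [set l].

Lemma cliff_gen_sqr (l : 'I_n) : cliff_gen l * cliff_gen l = -1.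
Proof.
rewrite [LHS]cliff_mul_blade /blade_sign big_set1 big_mkcondr big_set1 leqnn.
by rewrite scaleN1r /symdiff finset.setDv finset.setU0.
Qed.

Lemma cliff_gen_anticomm (l m : 'I_n) : l != m ->
  cliff_gen l * cliff_gen m + cliff_gen m * cliff_gen l = 0.
Proof.
move=> lm; rewrite [X in X + _]cliff_mul_blade [X in _ + X]cliff_mul_blade.
have -> : symdiff [set m] [set l] = symdiff [set l] [set m].
  by rewrite /symdiff finset.setUC.
rewrite -scalerDl /blade_sign !big_set1 !big_mkcondr !big_set1.
case: (ltngtP l m) => [_|_|/ord_inj/eqP]; last by rewrite (negbTE lm).
  by rewrite addrC addNr scale0r.
by rewrite addNr scale0r.
Qed.

Lemma blade_gen (A : {set 'I_n}) : blade A = \prod_(l <- enum A) cliff_gen l.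
Proof.
suff H (s : seq 'I_n) : sorted ltn (map val s) ->
    \prod_(l <- s) cliff_gen l = blade [set x in s].
  rewrite H; first by congr blade; apply/setP => x; rewrite inE mem_enum.
  apply: (@subseq_sorted _ _ ltn_trans _ (map val (enum 'I_n))); last first.
    by rewrite val_enum_ord iota_ltn_sorted.
  by apply: map_subseq; rewrite enumT; exact: filter_subseq.
elim: s => [_|i s IHs] /=.
  by rewrite big_nil; congr blade; apply/setP => x; rewrite !inE.
rewrite (path_sortedE ltn_trans) => /andP[/allP is_ s_sorted].
have nis j : j \in s -> (i < j)%N by move=> js; apply: is_; exact: map_f.
rewrite big_cons IHs // [LHS]cliff_mul_blade /blade_sign big_set1 big1; last first.
  by move=> j /andP[]; rewrite inE => /nis; rewrite ltnNge => /negbTE ->.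
rewrite scale1r; congr blade; apply/setP => x; rewrite !inE.
case: eqP => [->|_] /=; last by rewrite andbF.
by rewrite andbT orbF; apply/negP => /nis; rewrite ltnn.
Qed.

End CliffordFacts.

Section CliffordAnalysis.
Context {R : realType} {n : nat}.
Implicit Types x : 'rV[R]_n.+1.

Definition paravector x : clifford R n :=
  (x ord0 ord0)%:A + \sum_(l < n) x ord0 (lift ord0 l) *: cliff_gen l.

Definition paravector_conj x : clifford R n :=
  (x ord0 ord0)%:A - \sum_(l < n) x ord0 (lift ord0 l) *: cliff_gen l.

Definition laplacian (f : 'rV[R]_n.+1 -> clifford R n) x : clifford R n :=
  \sum_(i < n.+1) 'D_(delta_mx ord0 i) ('D_(delta_mx ord0 i) f) x.

(* ['D_v f] is a total operator; this says that every partial derivative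
   occurring in [iter m laplacian f] exists at every point. *)
Definition iter_laplacian_exists (m : nat) (f : 'rV[R]_n.+1 -> clifford R n) :=
  forall (j : nat) (i : 'I_n.+1) x, (j < m)%N ->
    let g := iter j laplacian f in
    derivable g x (delta_mx ord0 i) /\
    derivable ('D_(delta_mx ord0 i) g) x (delta_mx ord0 i).

Definition cliff_exp x : clifford R n :=
  lim (series (fun k => (k`!%:R^-1 : R) *: paravector x ^+ k) @ \oo).

Definition cliff_sinh x : clifford R n :=
  lim (series (fun k =>
    ((k.*2.+1)`!%:R^-1 : R) *: paravector x ^+ k.*2.+1) @ \oo).

Definition cliff_cosh x : clifford R n :=
  lim (series (fun k => ((k.*2)`!%:R^-1 : R) *: paravector x ^+ k.*2) @ \oo).

Definition cliff_sin x : clifford R n :=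
  lim (series (fun k =>
    ((-1) ^+ k / (k.*2.+1)`!%:R : R) *: paravector x ^+ k.*2.+1) @ \oo).

Definition cliff_cos x : clifford R n :=
  lim (series (fun k =>
    ((-1) ^+ k / (k.*2)`!%:R : R) *: paravector x ^+ k.*2) @ \oo).

End CliffordAnalysis.

Section Appell.
Context {R : realType}.

(* The rising factorial (a)_s. *)
Definition pochhammer (a : R) (s : nat) : R := \prod_(i < s) (a + i%:R).

Definition appell_coef (n k s : nat) : R :=
  'C(k, s)%:R * (pochhammer (n.+1%:R / 2) (k - s) *
                 pochhammer ((n%:R - 1) / 2) s) / pochhammer n%:R k.

Definition appell (n k : nat) (x : 'rV[R]_n.+1) : clifford R n :=
  \sum_(s < k.+1)
    appell_coef n k s *: (paravector x ^+ (k - s) * paravector_conj x ^+ s).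

Definition Gamma (z : R) : R :=
  Rintegral lebesgue_measure `]0, +oo[ (fun t => t `^ (z - 1) * expR (- t)).

(* With n = 2m + 1, the m-th iterate of the Laplacian sends x^k to
   gamma_const n * k! / (k - 2m)! * P_(k - 2m)(x), and to 0 if k < 2m.  For sin
   and cos the shift of the index by m in the alternating series leaves a
   factor (-1)^m in front of gamma_const n; e.g. for n = 3 the Laplacian of cos
   at 0 is 2, whereas gamma_const 3 = -2 and the Appell series there is 1. *)
Definition gamma_const (n : nat) : R :=
  (-1) ^+ n.-1./2 * 2 ^+ n.-1 / n.-1`!%:R * Gamma (n.+1%:R / 2) ^+ 2.

End Appell.

(* Main.v *)
(* In the variable z, put D = 1 - 2 x_0 z + |x|^2 z^2 = (1 - x z) (1 - conj x z).
   The generating series of the powers of x is (1 - x z)^-1 = (1 - conj x z) D^-1.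
   Writing n for the number of generators, a computation with the real function
   D gives
     Laplacian ((1 - conj x z) D^-l)
       = 2 l (2 l - 1 - n) z^2 (1 - conj x z) D^-(l + 1),
   so for n = 2 m + 1 the m-th iterate of the Laplacian turns x^k into a constant
   times the coefficient of z^(k - 2 m) in
     (1 - conj x z) D^-(m + 1) = (1 - x z)^-(m + 1) (1 - conj x z)^-m,
   which the negative binomial series identifies with P_(k - 2 m) (x).  The
   derivatives of sum_k d_k x^k are taken term by term because the coefficients
   of D^-l (Gegenbauer polynomials) and their second-order Taylor remainders are
   dominated by geometric sequences. *)
Require Import Defs.
From HB Require Import structures.
From mathcomp Require Import all_boot all_order all_algebra.
From mathcomp Require Import all_classical all_reals all_analysis.
From mathcomp Require Import measurable_realfun ring lra.

Set Implicit Arguments.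
Unset Strict Implicit.
Unset Printing Implicit Defensive.

Import Order.TTheory GRing.Theory Num.Theory.
Import numFieldNormedType.Exports.

Local Open Scope classical_set_scope.
Local Open Scope ring_scope.

(** * Power series in [(1 - u z + w z ^ 2)] and Gegenbauer polynomials *)

Section Rshift.
Context {V : zmodType}.
Implicit Types (F : nat -> V) (i j k : nat).

(** Coefficients of [z ^ j] times the power series with coefficients [F]. *)
Definition rshift_seq j F k : V := if (j <= k)%N then F (k - j)%N else 0.

Lemma rshift_seq0 F k : rshift_seq 0 F k = F k.
Proof. by rewrite /rshift_seq subn0. Qed.

Lemma rshift_seqD i j F k : rshift_seq i (rshift_seq j F) k = rshift_seq (i + j) F k.
Proof.
rewrite /rshift_seq; case: leqP => ik; last by rewrite leqNgt ltn_addr.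
by rewrite leq_subRL // subnDA.
Qed.

Lemma rshift_seq_lt j F k : (k < j)%N -> rshift_seq j F k = 0.
Proof. by move=> kj; rewrite /rshift_seq leqNgt kj. Qed.

Lemma rshift_seq_add j F k : rshift_seq j F (j + k) = F k.
Proof. by rewrite /rshift_seq leq_addr addKn. Qed.

End Rshift.

Section FormalQuadratic.
Context {R : comNzRingType}.
Implicit Types (u w : R) (F : nat -> R).

(* Sequences stand for power series in a variable [z]; these are the
   multiplication and the division by [1 - u z + w z ^ 2]. *)
Definition quad_mul u w F k : R :=
  F k - u * rshift_seq 1 F k + w * rshift_seq 2 F k.

(** The pair holds the coefficients of index [k] and [k - 1], with [0] at index [-1], so that the
    two-term recurrence is structural. *)
Fixpoint quad_div_rec u w F k : R * R :=
  if k is k'.+1 then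
    let h := quad_div_rec u w F k' in (F k + u * h.1 - w * h.2, h.1)
  else (F 0%N, 0).

Definition quad_div u w F k : R := (quad_div_rec u w F k).1.

Lemma quad_divK u w F k : quad_mul u w (quad_div u w F) k = F k.
Proof.
case: k => [|[|k]]; rewrite /quad_mul /rshift_seq /quad_div /= ?subn1 ?subn2 /=;
  ring.
Qed.

(* Coefficients of [(1 - u z + w z ^ 2) ^- l]: Gegenbauer polynomials, made
   homogeneous. *)
Definition gegenbauer u w l : nat -> R :=
  iter l (quad_div u w) (fun k => (k == 0%N)%:R).

Lemma gegenbauerS u w l k :
  gegenbauer u w l k =
  gegenbauer u w l.+1 k - u * rshift_seq 1 (gegenbauer u w l.+1) k
  + w * rshift_seq 2 (gegenbauer u w l.+1) k.
Proof. by rewrite -[RHS]/(quad_mul u w _ k) quad_divK. Qed.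

Lemma rshift_gegenbauerS j u w l k :
  rshift_seq j (gegenbauer u w l) k =
  rshift_seq j (gegenbauer u w l.+1) k
  - u * rshift_seq j.+1 (gegenbauer u w l.+1) k
  + w * rshift_seq j.+2 (gegenbauer u w l.+1) k.
Proof.
rewrite -[j.+2]addn2 -[j.+1]addn1 -!rshift_seqD /rshift_seq; case: ifP => // _.
  by rewrite gegenbauerS.
by rewrite !mulr0 subr0 addr0.
Qed.

End FormalQuadratic.

(** * Geometric bounds and Taylor remainders of Gegenbauer coefficients *)

Section Domination.
Context {R : realFieldType}.
Implicit Types (u w B C : R) (F G : nat -> R).

Definition dominated C B F := forall k, `|F k| <= C * B ^+ k.

Lemma dominated_rshift j C B F : 0 <= C -> 1 <= B -> dominated C B F ->
  dominated C B (rshift_seq j F).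
Proof.
move=> C0 B1 FB k; rewrite /rshift_seq; case: ifP => _.
  by apply: le_trans (FB _) _; rewrite ler_wpM2l // ler_weXn2l // leq_subr.
by rewrite normr0 mulr_ge0 // exprn_ge0 // (le_trans ler01).
Qed.

(** The hypothesis on [B] reads [|u| / B + |w| / B ^ 2 <= 1 / 2]. In the recurrence for division by
    the quadratic, the two earlier terms thus contribute at most half of [2 * C * B ^ k], and the
    source term the other half. *)
Lemma dominated_quad_div u w C B F : 0 <= C -> 1 <= B ->
  2 * (`|u| * B + `|w|) <= B ^+ 2 ->
  dominated C B (quad_mul u w F) -> dominated (2 * C) B F.
Proof.
move=> C0 B1 uwB FB k.
have B0 : 0 < B by apply: lt_le_trans B1.
(* The recurrence has depth two, so two consecutive bounds are carried. *)
suff: `|F k| <= 2 * C * B ^+ k /\ `|F k.+1| <= 2 * C * B ^+ k.+1 by case.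
have FE j : F j = quad_mul u w F j + u * rshift_seq 1 F j - w * rshift_seq 2 F j.
  by rewrite /quad_mul; ring.
have uB : 2 * `|u| <= B.
  rewrite -(ler_pM2r B0) -expr2 (le_trans _ uwB) // mulrDr mulrA lerDl.
  by rewrite mulr_ge0.
elim: k => [|k [IHk IHk1]].
  have F0 : `|F 0%N| <= C.
    by have := FB 0%N; rewrite /quad_mul !rshift_seq_lt // !mulr0 subr0 addr0 expr0 mulr1.
  split; first by rewrite expr0 mulr1; lra.
  rewrite FE [rshift_seq 2 F 1]rshift_seq_lt // mulr0 subr0.
  rewrite [rshift_seq 1 F 1](rshift_seq_add 1 F 0).
  rewrite (le_trans (ler_normD _ _)) // normrM expr1.
  have := FB 1%N; rewrite expr1 => FB1.
  have : `|u| * `|F 0%N| <= B / 2 * C.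
    by rewrite ler_pM //; lra.
  have CB0 : 0 <= C * B by rewrite mulr_ge0 // ltW.
  by move=> h; apply: (le_trans (lerD FB1 h)); lra.
split=> //; rewrite FE [rshift_seq 1 F _](rshift_seq_add 1) (rshift_seq_add 2).
rewrite (le_trans (ler_normB _ _)) // (le_trans (lerD (ler_normD _ _) (lexx _))) //.
rewrite !normrM.
have h1 := FB k.+2.
have h2 : `|u| * `|F k.+1| <= `|u| * (2 * C * B ^+ k.+1) by rewrite ler_wpM2l.
have h3 : `|w| * `|F k| <= `|w| * (2 * C * B ^+ k) by rewrite ler_wpM2l.
apply: (le_trans (lerD (lerD h1 h2) h3)).
have : C * B ^+ k * (2 * (`|u| * B + `|w|)) <= C * B ^+ k * B ^+ 2.
  by rewrite ler_wpM2l // mulr_ge0 // exprn_ge0 // ltW.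
by rewrite !exprS expr0; lra.
Qed.

Lemma dominated_gegenbauer u w B l : 1 <= B ->
  2 * (`|u| * B + `|w|) <= B ^+ 2 -> dominated (2 ^+ l) B (gegenbauer u w l).
Proof.
move=> B1 uwB; elim: l => [|l IHl].
  move=> k; rewrite /gegenbauer /= expr0 mul1r.
  have Bk := exprn_ege1 k B1.
  by case: (k == 0%N); rewrite ?normr1 ?normr0 ?(le_trans ler01).
rewrite exprS; apply: (@dominated_quad_div u w) => //.
by move=> k; rewrite quad_divK; exact: IHl.
Qed.

(** Coefficients of [l (p z - q z ^ 2) D ^- (l + 1)], the derivative of [D ^- l] at [t = 0] when [u]
    and [w] become [u + t p] and [w + t q + t ^ 2]. *)
Definition gegenbauer_deriv u w p q l k : R :=
  l%:R * (p * rshift_seq 1 (gegenbauer u w l.+1) k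
          - q * rshift_seq 2 (gegenbauer u w l.+1) k).

(* With [D = 1 - u z + w z ^ 2], [D'] its perturbation and
   [N = - p z + q z ^ 2], the remainder
   [E l = D' ^- l - D ^- l + l t N D ^- (l + 1)] satisfies
   [D' E (l + 1) = E l + t ^ 2 (...)], and [quad_div] preserves domination. *)
Lemma gegenbauer_taylor u w p q B l : 1 <= B ->
  (forall t, `|t| <= 1 ->
    2 * (`|u + t * p| * B + `|w + t * q + t ^+ 2|) <= B ^+ 2) ->
  exists2 C, 0 <= C & forall t, `|t| <= 1 ->
    dominated (C * t ^+ 2) B (fun k =>
      gegenbauer (u + t * p) (w + t * q + t ^+ 2) l k - gegenbauer u w l k
      - t * gegenbauer_deriv u w p q l k).
Proof.
move=> B1 uwB.
have uwB0 : 2 * (`|u| * B + `|w|) <= B ^+ 2.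
  by have := uwB 0; rewrite normr0 expr0n !mul0r !addr0; apply.
elim: l => [|l [C C0 IHl]].
  exists 0 => // t _ k; rewrite /gegenbauer_deriv /gegenbauer /= mul0r mulr0.
  by rewrite subrr subr0 normr0 !mul0r.
pose C1 : R := 2 ^+ l.+1; pose C2 : R := 2 ^+ l.+2.
(* [C1] and [C2] bound the coefficients of [D ^- (l + 1)] and [D ^- (l + 2)] relative to [B ^ k];
   [M] is the resulting bound for [S] below when [|t| <= 1]. *)
pose M := C1 + l.+1%:R * C2 * ((`|p| + `|q|) ^+ 2 + (`|p| + `|q|)).
have C1_ge0 : 0 <= C1 by rewrite exprn_ge0.
have C2_ge0 : 0 <= C2 by rewrite exprn_ge0.
have M0 : 0 <= M.
  rewrite addr_ge0 // mulr_ge0 ?mulr_ge0 // addr_ge0 ?exprn_ge0 //; exact: addr_ge0.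
exists (2 * (C + M)); first by rewrite mulr_ge0 // addr_ge0.
move=> t t1.
rewrite -mulrA; set u' := u + t * p; set w' := w + t * q + t ^+ 2.
have t2_ge0 : 0 <= t ^+ 2 by exact: sqr_ge0.
apply: (@dominated_quad_div u' w') => //.
- by rewrite mulr_ge0 // addr_ge0.
- exact: uwB.
move=> k; set E := (fun k => _).
pose G1 := gegenbauer u w l.+1; pose G2 := gegenbauer u w l.+2.
pose G' := gegenbauer u' w' l.+1.
have rE j : rshift_seq j E k = rshift_seq j G' k - rshift_seq j G1 k
    - t * (l.+1%:R * (p * rshift_seq j.+1 G2 k - q * rshift_seq j.+2 G2 k)).
  rewrite -[j.+2]addn2 -[j.+1]addn1 -!rshift_seqD /rshift_seq /E.
  by case: ifP => _ //; rewrite !mulr0 !subr0 !mulr0 subr0.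
(* The coefficient of [z ^ k] in [- z ^ 2 D ^- (l + 1) + (l + 1) (N ^ 2 + t z ^ 2 N) D ^- (l + 2)],
   which is the factor of [t ^ 2] in [D' E (l + 1) - E l]. *)
pose S : R := - rshift_seq 2 G1 k + l.+1%:R * (
  p ^+ 2 * rshift_seq 2 G2 k - 2 * p * q * rshift_seq 3 G2 k
  + q ^+ 2 * rshift_seq 4 G2 k
  + t * (q * rshift_seq 4 G2 k - p * rshift_seq 3 G2 k)).
have -> : quad_mul u' w' E k = gegenbauer u' w' l k - gegenbauer u w l k
    - t * gegenbauer_deriv u w p q l k + t ^+ 2 * S.
  rewrite /quad_mul !rE -(rshift_seq0 E k) rE /S /gegenbauer_deriv -/G1.
  rewrite (gegenbauerS u' w') (gegenbauerS u w) -/G1 -/G' !rshift_seq0.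
  have r j : rshift_seq j G1 k = rshift_seq j G2 k - u * rshift_seq j.+1 G2 k
      + w * rshift_seq j.+2 G2 k by exact: rshift_gegenbauerS.
  have r0 := r 0%N; rewrite !rshift_seq0 in r0; rewrite r0 !r.
  by rewrite /u' /w' -natr1; ring.
rewrite (le_trans (ler_normD _ _)) //.
rewrite [X in _ <= X * _]mulrDl mulrDl lerD //; first exact: IHl.
rewrite normrM ger0_norm // [M * _ * _]mulrAC [M * _ * _]mulrC ler_wpM2l //.
have dG1 j : `|rshift_seq j G1 k| <= C1 * B ^+ k.
  by apply: dominated_rshift => //; exact: dominated_gegenbauer.
have dG2 j : `|rshift_seq j G2 k| <= C2 * B ^+ k.
  by apply: dominated_rshift => //; exact: dominated_gegenbauer.
have Bk : 0 <= B ^+ k by rewrite exprn_ge0 // (le_trans ler01).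
have MD (a b c d : R) : `|a| <= b -> `|c| <= d -> `|a + c| <= b + d.
  by move=> ab cd; rewrite (le_trans (ler_normD _ _)) ?lerD.
have MM (a b c : R) : `|a| <= b -> `|c * a| <= `|c| * b.
  by move=> ab; rewrite normrM ler_wpM2l.
have -> : M * B ^+ k = C1 * B ^+ k + `|l.+1%:R : R| *
   (`|p ^+ 2| * (C2 * B ^+ k) + `|- (2 * p * q)| * (C2 * B ^+ k)
    + `|q ^+ 2| * (C2 * B ^+ k)
    + 1 * (`|q| * (C2 * B ^+ k) + `|- p| * (C2 * B ^+ k))).
  by rewrite !normrN !normrM !normr_nat /M; ring.
rewrite /S -!mulNr; apply: (MD); first by rewrite normrN.
apply: (MM); apply: (MD); last first.
  rewrite normrM; apply: ler_pM => //.
  by apply: (MD); exact: (MM).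
apply: (MD); last exact: (MM).
by apply: (MD); exact: (MM).
Qed.

End Domination.

(** * Termwise summation and differentiation *)

Section Pairing.
Context {R : realType}.
Implicit Types (d F G : nat -> R) (B C : R).

(** Infinite radius of convergence, stated for the radii [B >= 1] that the domination bounds
    supply. *)
Definition entire d :=
  forall B, 1 <= B -> cvgn (series (fun k => `|d k| * B ^+ k)).

Lemma entire_fact d : (forall k, `|d k| <= k`!%:R^-1) -> entire d.
Proof.
move=> dfact B B1; have B0 : 0 <= B by apply: le_trans B1.
apply: (series_le_cvg _ _ _ (is_cvg_series_exp_coeff B)) => k.
- by rewrite mulr_ge0 // exprn_ge0.
- by rewrite exp_coeff_ge0.
- by rewrite exp_coeffE /= ler_wpM2r // exprn_ge0.
Qed.

Lemma entire_shift d : entire d -> entire (d \o succn).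
Proof.
move=> ed B B1; have B0 : 0 <= B by apply: le_trans B1.
have /cvg_ex[l dl] := ed B B1.
apply: (@series_le_cvg _ _ (fun k => `|d k.+1| * B ^+ k.+1)) => [k|k|k|].
- by rewrite mulr_ge0 // exprn_ge0.
- by rewrite mulr_ge0 // exprn_ge0.
- by rewrite ler_wpM2l // exprS ler_peMl // exprn_ge0.
apply/cvg_ex; exists (l - `|d 0%N|).
have -> : series (fun k => `|d k.+1| * B ^+ k.+1) =
    (fun k => series (fun k => `|d k| * B ^+ k) k.+1 - `|d 0%N|).
  apply/funext => k; rewrite /series /= big_nat_recl // expr0 mulr1.
  by rewrite addrC addKr.
by apply: cvgB; [rewrite (cvg_shiftS (series _)) | exact: cvg_cst].
Qed.

(** A linear functional of [F]: through it, formal identities between power series in [z] become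
    identities between the functions with Taylor coefficients [d]. *)
Definition pairing d F : R := limn (series (fun k => d k * F k)).

Definition pairable d F := cvgn (series (fun k => d k * F k)).

Lemma entire_pairable d F C B : entire d -> 0 <= C -> 1 <= B ->
  dominated C B F -> pairable d F.
Proof.
move=> ed C0 B1 FB; have B0 : 0 <= B by apply: le_trans B1.
apply: normed_cvg.
apply: (@series_le_cvg _ _ (fun k => C * (`|d k| * B ^+ k))) => [k|k|k|].
- exact: normr_ge0.
- by rewrite !mulr_ge0 // exprn_ge0.
- by rewrite /= normrM mulrCA ler_wpM2l.
- exact: (is_cvg_seriesZ (k := C) (ed B B1)).
Qed.

Lemma pairing_dominated d F C B : entire d -> 0 <= C -> 1 <= B ->
  dominated C B F -> `|pairing d F| <= C * limn (series (fun k => `|d k| * B ^+ k)).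
Proof.
move=> ed C0 B1 FB; have B0 : 0 <= B by apply: le_trans B1.
have cb := is_cvg_seriesZ (k := C) (ed B B1).
have cn : cvgn [normed series (fun k => d k * F k)].
  apply: (@series_le_cvg _ _ (fun k => C * (`|d k| * B ^+ k))) => [k|k|k|//].
  - exact: normr_ge0.
  - by rewrite !mulr_ge0 // exprn_ge0.
  - by rewrite /= normrM mulrCA ler_wpM2l.
apply: (le_trans (lim_series_norm cn)).
rewrite -[leRHS](lim_seriesZ C (ed B B1)).
by apply: lim_series_le => // k; rewrite /= normrM [leRHS]mulrCA ler_wpM2l.
Qed.

Lemma pairingZD d F G a : pairable d F -> pairable d G ->
  pairable d (fun k => F k + a * G k) /\
  pairing d (fun k => F k + a * G k) = pairing d F + a * pairing d G.
Proof.
move=> cF cG.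
have E : (fun k => d k * (F k + a * G k)) =
    (fun k => d k * F k) + a *: (fun k => d k * G k).
  by apply/funext => k; rewrite mulrDr mulrCA.
have cZ := is_cvg_seriesZ (k := a) cG.
split; first by rewrite /pairable E; exact: is_cvg_seriesD.
by rewrite /pairing E lim_seriesD // lim_seriesZ.
Qed.

(** Multiplication by [z] is adjoint to dropping the first coefficient of [d]. *)
Lemma pairing_rshift d F : pairable (d \o succn) F ->
  pairable d (rshift_seq 1 F) /\
  pairing d (rshift_seq 1 F) = pairing (d \o succn) F.
Proof.
move=> cF.
suff h : series (fun k => d k * rshift_seq 1 F k) @ \oo --> pairing (d \o succn) F.
  by split; [apply/cvg_ex; eexists; exact: h | exact: cvg_lim].
rewrite -cvg_shiftS.
rewrite (_ : (fun k => _) = series (fun k => (d \o succn) k * F k)) //.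
apply/funext => k; rewrite /series /= big_nat_recl // rshift_seq_lt // mulr0 add0r.
by apply: eq_bigr => i _; rewrite -[i.+1]/(1 + i)%N rshift_seq_add.
Qed.

End Pairing.

(** * Entire series of Gegenbauer coefficients *)

Section GegenbauerSeries.
Context {R : realType}.
Implicit Types (d : nat -> R) (u w p q : R) (l : nat).

Definition gegenbauer_series l d u w : R := pairing d (gegenbauer u w l).

(** One [B] serves all [|t| <= 1], so a single geometric sequence dominates all the perturbed
    series. *)
Lemma gegenbauer_radius u w p q : exists2 B : R, 1 <= B & forall t, `|t| <= 1 ->
  2 * (`|u + t * p| * B + `|w + t * q + t ^+ 2|) <= B ^+ 2.
Proof.
pose U := `|u| + `|p|; pose W := `|w| + `|q| + 1.
have U0 : 0 <= U by exact: addr_ge0.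
have W0 : 0 <= W by rewrite addr_ge0 // addr_ge0.
(* This choice gives [B ^ 2 = B + 2 U B + 2 W B], and [W <= W B]. *)
exists (1 + 2 * (U + W)) => [|t t1]; first by lra.
set B := 1 + _; have B1 : 1 <= B by rewrite /B; lra.
have tM (a : R) : `|t * a| <= `|a| by rewrite normrM ler_piMl.
have uU : `|u + t * p| <= U by rewrite (le_trans (ler_normD _ _)) // lerD2l.
have wW : `|w + t * q + t ^+ 2| <= W.
  rewrite (le_trans (ler_normD _ _)) // lerD //.
    by rewrite (le_trans (ler_normD _ _)) // lerD2l.
  by rewrite expr2 (le_trans (tM t)).
have : `|u + t * p| * B <= U * B by rewrite ler_wpM2r // (le_trans ler01).
have : W <= W * B by rewrite ler_peMr.
have -> : B ^+ 2 = B + 2 * (U * B) + 2 * (W * B) by rewrite /B; ring.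
by lra.
Qed.

Lemma gegenbauer_dominated u w l : exists B, 1 <= B /\
  dominated (2 ^+ l) B (gegenbauer u w l).
Proof.
have [B B1 /(_ 0)] := gegenbauer_radius u w 0 0.
rewrite normr0 expr0n !mul0r !addr0 => /(_ ler01) uwB.
by exists B; split => //; exact: dominated_gegenbauer.
Qed.

Lemma pairable_gegenbauer l d u w : entire d -> pairable d (gegenbauer u w l).
Proof.
move=> ed; have [B [B1 dB]] := gegenbauer_dominated u w l.
by apply: entire_pairable ed _ B1 dB; exact: exprn_ge0.
Qed.

Lemma pairing_rshift1_gegenbauer l d u w : entire d ->
  pairable d (rshift_seq 1 (gegenbauer u w l)) /\
  pairing d (rshift_seq 1 (gegenbauer u w l))
    = gegenbauer_series l (d \o succn) u w.
Proof.
move=> ed; apply: pairing_rshift.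
by apply: pairable_gegenbauer; exact: entire_shift.
Qed.

Lemma pairing_rshift2_gegenbauer l d u w : entire d ->
  pairable d (rshift_seq 2 (gegenbauer u w l)) /\
  pairing d (rshift_seq 2 (gegenbauer u w l))
    = gegenbauer_series l (d \o succn \o succn) u w.
Proof.
move=> ed.
have -> : rshift_seq 2 (gegenbauer u w l) =
    rshift_seq 1 (rshift_seq 1 (gegenbauer u w l)).
  by apply/funext => k; rewrite rshift_seqD.
have es := entire_shift ed.
have [c1 e1] := @pairing_rshift1_gegenbauer l (d \o succn) u w es.
have [c2 ->] := pairing_rshift c1.
by split.
Qed.

Lemma gegenbauer_seriesS l d u w : entire d ->
  gegenbauer_series l d u w =
  gegenbauer_series l.+1 d u w - u * gegenbauer_series l.+1 (d \o succn) u w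
  + w * gegenbauer_series l.+1 (d \o succn \o succn) u w.
Proof.
move=> ed.
have c0 := @pairable_gegenbauer l.+1 d u w ed.
have [c1 e1] := @pairing_rshift1_gegenbauer l.+1 d u w ed.
have [c2 e2] := @pairing_rshift2_gegenbauer l.+1 d u w ed.
have [c3 e3] := pairingZD (- u) c0 c1; have [_ e4] := pairingZD w c3 c2.
rewrite -mulNr -e1 -e2 {2}/gegenbauer_series -e3 -e4 /gegenbauer_series.
by congr pairing; apply/funext => k; rewrite gegenbauerS mulNr.
Qed.

(** Termwise differentiation: the coefficientwise remainders are [O(t ^ 2)] with one geometric
    bound, which [pairing d] sums to a constant [K] independent of [t]. *)
Lemma gegenbauer_series_taylor l d u w p q : entire d ->
  exists K, forall t, `|t| <= 1 ->
  `|gegenbauer_series l d (u + t * p) (w + t * q + t ^+ 2)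
    - gegenbauer_series l d u w
    - t * (l%:R * (p * gegenbauer_series l.+1 (d \o succn) u w
                   - q * gegenbauer_series l.+1 (d \o succn \o succn) u w))|
  <= K * t ^+ 2.
Proof.
move=> ed; have [B B1 uwB] := gegenbauer_radius u w p q.
have [C C0 Ct] := @gegenbauer_taylor _ u w p q B l B1 uwB.
exists (C * limn (series (fun k => `|d k| * B ^+ k))) => t t1.
have c0 := @pairable_gegenbauer l d (u + t * p) (w + t * q + t ^+ 2) ed.
have c0' := @pairable_gegenbauer l d u w ed.
have [c1 e1] := @pairing_rshift1_gegenbauer l.+1 d u w ed.
have [c2 e2] := @pairing_rshift2_gegenbauer l.+1 d u w ed.
have [c3 e3] := pairingZD (- 1) c0 c0'.
have [c4 e4] := pairingZD (- (t * l%:R * p)) c3 c1.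
have [c5 e5] := pairingZD (t * l%:R * q) c4 c2.
rewrite mulrAC; have := pairing_dominated ed _ B1 (Ct t t1).
rewrite mulr_ge0 ?sqr_ge0 // => /(_ isT); apply: le_trans.
rewrite (_ : pairing d _ = pairing d (fun k =>
       gegenbauer (u + t * p) (w + t * q + t ^+ 2) l k + -1 * gegenbauer u w l k +
       - (t * l%:R * p) * rshift_seq 1 (gegenbauer u w l.+1) k +
       t * l%:R * q * rshift_seq 2 (gegenbauer u w l.+1) k)); last first.
  by congr pairing; apply/funext => k; rewrite /gegenbauer_deriv; ring.
rewrite e5 e4 e3 e1 e2 /gegenbauer_series -/(pairing _ _).
by rewrite le_eqVlt; apply/orP; left; apply/eqP; congr (`| _ |); ring.
Qed.

End GegenbauerSeries.

(** * Directional derivatives from quadratic remainder bounds *)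

Section DirectionalDerivative.
Context {R : realType} {V W : normedModType R}.

Lemma is_derive_taylor (f : V -> W) (x v : V) (L : W) (K : R) :
  (forall t, `|t| <= 1 -> `|f (x + t *: v) - f x - t *: L| <= K * t ^+ 2) ->
  is_derive x v f L.
Proof.
move=> fK.
have h : (fun h => h^-1 *: ((f \o shift x) (h *: v) - f x)) @ 0^' --> L.
  apply/cvgrPdist_le => e e0; near=> t.
  have t0 : t != 0 by near: t; exact: nbhs_dnbhs_neq.
  have t1 : `|t| <= 1.
    near: t; apply: dnbhs0_le; exact: ltr01.
  (* No sign of [K] is assumed; [|K| + 1] is a positive majorant to divide by. *)
  have tK : `|t| * (`|K| + 1) <= e.
    rewrite -ler_pdivlMr ?ltr_wpDl //; near: t; apply: dnbhs0_le.
    by rewrite divr_gt0 // ltr_wpDl.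
  have -> : L - t^-1 *: ((f \o shift x) (t *: v) - f x) =
      - (t^-1 *: (f (x + t *: v) - f x - t *: L)).
    by rewrite /= [t *: v + x]addrC [in RHS]scalerBr scalerA mulVf // scale1r opprB.
  rewrite normrN normrZ normfV ler_pdivrMl ?normr_gt0 //.
  apply: (le_trans (fK t t1)).
  apply: (@le_trans _ _ ((`|K| + 1) * t ^+ 2)).
    by rewrite ler_wpM2r ?sqr_ge0 // (le_trans (ler_norm _)) // lerDl.
  by rewrite -(real_normK (num_real t)) expr2 mulrCA ler_wpM2l // mulrC.
by split; [apply/cvg_ex; exists L | exact: cvg_lim].
Unshelve. all: by end_near. Qed.

Lemma is_deriveZl (f : V -> R) (c : W) (x v : V) (L : R) :
  is_derive x v f L -> is_derive x v (fun y => f y *: c) (L *: c).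
Proof.
move=> [df dL].
have h : (fun h => h^-1 *: (((fun y => f y *: c) \o shift x) (h *: v) - f x *: c))
    @ 0^' --> L *: c.
  have -> : (fun h => h^-1 *: (((fun y => f y *: c) \o shift x) (h *: v) - f x *: c))
     = (fun h => (h^-1 *: ((f \o shift x) (h *: v) - f x)) *: c).
    by apply/funext => h; rewrite /= -scalerBl scalerA.
  by apply: cvgZr_tmp; rewrite -dL.
by split; [apply/cvg_ex; exists (L *: c) | exact: cvg_lim].
Qed.

End DirectionalDerivative.

(** * The Laplacian of the Gegenbauer series *)

Section Zonal.
Context {R : realType} {n : nat}.
Implicit Types (d : nat -> R) (x : 'rV[R]_n.+1) (l : nat) (i k : 'I_n.+1).

Notation e_ i := (delta_mx ord0 i : 'rV[R]_n.+1).

Definition sqnorm x : R := \sum_i x ord0 i ^+ 2.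

(** The pairing of [d] with [D ^- l], where [D = 1 - 2 x_0 z + |x| ^ 2 z ^ 2]. *)
Definition zonal l d x : R :=
  gegenbauer_series l d (2 * x ord0 ord0) (sqnorm x).

(** From [- l D_i D ^- (l + 1)], where [D_i = - 2 [i = 0] z + 2 x_i z ^ 2] is the partial derivative
    of [D]; each factor [z] becomes one [\o succn] on [d]. *)
Definition dzonal l d i x : R :=
  l%:R * (2 * (i == ord0)%:R * zonal l.+1 (d \o succn) x
          - 2 * (x ord0 i * zonal l.+1 (d \o succn \o succn) x)).

Definition ddzonal l d i x : R :=
  l%:R * (2 * (i == ord0)%:R * dzonal l.+1 (d \o succn) i x
          - 2 * (zonal l.+1 (d \o succn \o succn) x
                 + x ord0 i * dzonal l.+1 (d \o succn \o succn) i x)).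

Lemma is_derive_coord x k i : is_derive x (e_ i) (fun y => y ord0 k) (k == i)%:R.
Proof.
apply: (@is_derive_taylor _ _ _ _ _ _ _ 0) => t _.
by rewrite !mxE eqxx /= [_ - x _ _]addrAC subrr add0r subrr normr0 mul0r.
Qed.

Lemma sqnormD x i (t : R) :
  sqnorm (x + t *: e_ i) = sqnorm x + t * (2 * x ord0 i) + t ^+ 2.
Proof.
rewrite /sqnorm (bigD1 i) //= [in RHS](bigD1 i) //= !mxE !eqxx /=.
rewrite (eq_bigr (fun k => x ord0 k ^+ 2)) => [|k /negPf ki]; first by ring.
by rewrite !mxE ki andbF mulr0 addr0.
Qed.

(** Moving [x] by [t] along the axis [i] adds [2 [i = 0] t] to [2 x_0] and [2 x_i t + t ^ 2] to
    [|x| ^ 2], which is the perturbation of the Taylor bound. *)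
Lemma is_derive_zonal l d x i : entire d ->
  is_derive x (e_ i) (zonal l d) (dzonal l d i x).
Proof.
move=> ed.
have [K HK] := gegenbauer_series_taylor l (2 * x ord0 ord0) (sqnorm x)
  (2 * (i == ord0)%:R) (2 * x ord0 i) ed.
apply: (@is_derive_taylor _ _ _ _ _ _ _ K) => t t1.
rewrite {1}/zonal sqnormD !mxE eqxx /= [ord0 == i]eq_sym.
by rewrite mulrDr [2 * (t * _)]mulrCA /dzonal [2 * (_ * _)]mulrA; exact: HK.
Qed.

Lemma is_derive_dzonal l d x i : entire d ->
  is_derive x (e_ i) (dzonal l d i) (ddzonal l d i x).
Proof.
move=> ed; have es := entire_shift ed; have ess := entire_shift es.
have h1 := @is_derive_zonal l.+1 _ x i es.
have h2 := @is_derive_zonal l.+1 _ x i ess.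
have h3 := @is_derive_coord x i i.
have h4 := is_deriveZ (2 * (i == ord0)%:R) h1.
have h5 := is_deriveZ 2 (is_deriveM h3 h2).
have h6 := is_deriveZ l%:R (is_deriveB h4 h5).
rewrite (_ : dzonal l d i = l%:R *:
  ((2 * (i == ord0)%:R) *: zonal l.+1 (d \o succn)
    - 2 *: ((fun y : 'rV_n.+1 => y ord0 i) * zonal l.+1 (d \o succn \o succn)))).
  apply: (is_derive_eq h6).
  rewrite /ddzonal eqxx -![_ *: _]/(_ * _) mulr1; ring.
by [].
Qed.

(** The gradient of [D] has square norm [4 z ^ 2 D] and its Laplacian is [2 (n + 1) z ^ 2], so
    [D ^- l] has Laplacian [(4 l (l + 1) - 2 l (n + 1)) z ^ 2 D ^- (l + 1)]. *)
Lemma sum_ddzonal l d x : entire d ->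
  \sum_i ddzonal l d i x =
  2 * l%:R * (2 * l%:R + 1 - n%:R) * zonal l.+1 (d \o succn \o succn) x.
Proof.
move=> ed; have ess := entire_shift (entire_shift ed).
have := gegenbauer_seriesS l.+1 (2 * x ord0 ord0) (sqnorm x) ess.
rewrite -!/(zonal _ _ _).
set Z := zonal l.+1 _ x; set Z2 := zonal l.+2 _ x; set Z3 := zonal l.+2 _ x.
set Z4 := zonal l.+2 _ x => ZE.
have sumE a b c : \sum_i (a * (i == ord0)%:R + b + c * x ord0 i ^+ 2) =
    a + n.+1%:R * b + c * sqnorm x.
  rewrite !big_split /= -!mulr_sumr sumr_const card_ord mulr_natl.
  by rewrite (bigD1 ord0) //= big1 ?addr0 ?mulr1 // => i /negPf ->.
pose c : R := l%:R * 4 * l.+1%:R.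
rewrite (eq_bigr (fun i => c * (Z2 - 2 * x ord0 ord0 * Z3) * (i == ord0)%:R
    + - (l%:R * 2 * Z) + c * Z4 * x ord0 i ^+ 2)).
  by rewrite sumE ZE /c -!natr1; ring.
move=> i _; rewrite /ddzonal /dzonal -/Z -/Z2 -/Z3 -/Z4 /c.
by case: eqP => [->|_] /=; ring.
Qed.

End Zonal.

(** * The Laplacian of the Clifford-valued generating series *)

Section CliffordLaplacian.
Context {R : realType} {n : nat}.
Implicit Types (d : nat -> R) (x : 'rV[R]_n.+1) (l : nat) (i k : 'I_n.+1).

Notation e_ i := (delta_mx ord0 i : 'rV[R]_n.+1).

Definition conj_basis k : clifford R n :=
  if unlift ord0 k is Some j then - cliff_gen j else 1.

Lemma paravector_conjE x :
  paravector_conj x = \sum_k x ord0 k *: conj_basis k.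
Proof.
rewrite big_ord_recl /conj_basis unlift_none /paravector_conj; congr (_ + _).
by rewrite -sumrN; apply: eq_bigr => k _; rewrite liftK scalerN.
Qed.

(** The pairing of [d] with [(1 - conj x z) D ^- l]; for [l = 1] and entire [d] it is the sum of
    [d k *: x ^ k]. *)
Definition conj_zonal l d x : clifford R n :=
  zonal l d x *: 1 - zonal l (d \o succn) x *: paravector_conj x.

(** The derivatives of [conj_zonal] keep this shape, which reduces them to derivatives of real
    functions. *)
Definition conj_comb (f : R) (g : 'I_n.+1 -> R) : clifford R n :=
  f *: 1 - \sum_k g k *: conj_basis k.

Lemma conj_zonalE l d : conj_zonal l d =
  fun x => conj_comb (zonal l d x) (fun k => x ord0 k * zonal l (d \o succn) x).
Proof.
apply/funext => x; rewrite /conj_zonal paravector_conjE; congr (_ - _).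
by rewrite scaler_sumr; apply: eq_bigr => k _; rewrite scalerA mulrC.
Qed.

Lemma is_derive_conj_comb x i (f : 'rV[R]_n.+1 -> R) g f' g' :
  is_derive x (e_ i) f f' ->
  (forall k, is_derive x (e_ i) (fun y => g y k) (g' k)) ->
  is_derive x (e_ i) (fun y => conj_comb (f y) (g y)) (conj_comb f' g').
Proof.
move=> df dg.
have h1 := is_deriveZl (1 : clifford R n) df.
have h2 := is_derive_sum (fun k => is_deriveZl (conj_basis k) (dg k)).
rewrite (_ : (fun y => _) = (fun y => f y *: (1 : clifford R n)) -
   \sum_k (fun y => g y k *: conj_basis k)); first exact: is_deriveB.
by apply/funext => y; rewrite /conj_comb fctE fct_sumE.
Qed.

(** By the product rule the cross term is [- 2 z] times the sum over [k] of [conj e_k] times the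
    [k]-th derivative of [D ^- l], that is [- 4 l z ^ 2 (1 - conj x z) D ^- (l + 1)]. It lowers the
    factor [2 l + 1 - n] of [sum_ddzonal] to [2 l - 1 - n]. *)
Lemma laplacian_conj_zonal l d : entire d ->
  (forall x i, derivable (conj_zonal l d) x (e_ i) /\
    derivable ('D_(e_ i) (conj_zonal l d)) x (e_ i)) /\
  laplacian (conj_zonal l d) = (fun x =>
    (2 * l%:R * (2 * l%:R - 1 - n%:R)) *: conj_zonal l.+1 (d \o succn \o succn) x).
Proof.
move=> ed; have es := entire_shift ed.
have D1 i x : is_derive x (e_ i) (conj_zonal l d)
    (conj_comb (dzonal l d i x) (fun k =>
       (k == i)%:R * zonal l (d \o succn) x + x ord0 k * dzonal l (d \o succn) i x)).
  rewrite conj_zonalE; apply: is_derive_conj_comb; first exact: is_derive_zonal.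
  move=> k; have h := is_deriveM (is_derive_coord x k i) (is_derive_zonal l x i es).
  by apply: (is_derive_eq h); rewrite -![_ *: _]/(_ * _); ring.
have D1E i : 'D_(e_ i) (conj_zonal l d) = fun x =>
    conj_comb (dzonal l d i x) (fun k =>
       (k == i)%:R * zonal l (d \o succn) x + x ord0 k * dzonal l (d \o succn) i x).
  by apply/funext => x; exact: derive_val.
have D2 i x : is_derive x (e_ i) ('D_(e_ i) (conj_zonal l d))
    (conj_comb (ddzonal l d i x) (fun k => 2 * (k == i)%:R * dzonal l (d \o succn) i x
      + x ord0 k * ddzonal l (d \o succn) i x)).
  rewrite D1E; apply: is_derive_conj_comb; first exact: is_derive_dzonal.
  move=> k.
  have h1 := is_deriveZ ((k == i)%:R) (is_derive_zonal l x i es).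
  have h2 := is_deriveM (is_derive_coord x k i) (is_derive_dzonal l x i es).
  by apply: (is_derive_eq (is_deriveD h1 h2)); rewrite -![_ *: _]/(_ * _); ring.
split=> [x i|]; first by split; apply: ex_derive.
apply/funext => x; rewrite /laplacian.
rewrite (eq_bigr _ (fun i _ => @derive_val _ _ _ _ _ _ _ (D2 i x))).
rewrite /conj_comb big_split /= sumrN -scaler_suml sum_ddzonal //.
rewrite exchange_big /=.
rewrite (eq_bigr (fun k => (2 * dzonal l (d \o succn) k x + x ord0 k * (
   2 * l%:R * (2 * l%:R + 1 - n%:R) * zonal l.+1 (d \o succn \o succn \o succn) x))
    *: conj_basis k)); last first.
  move=> k _; rewrite -scaler_suml; congr (_ *: _).
  rewrite big_split /= -mulr_sumr sum_ddzonal //; congr (_ + _).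
  rewrite (bigD1 k) //= big1 ?addr0 ?eqxx ?mulr1 // => i /negPf.
  by rewrite eq_sym => ->; rewrite mulr0 mul0r.
set Z := zonal _ (_ \o _ \o _) x; set Z3 := zonal _ _ x.
rewrite (eq_bigr (fun k => (4 * l%:R * (k == ord0)%:R * Z) *: conj_basis k
   + (2 * l%:R * (2 * l%:R - 1 - n%:R) * (x ord0 k * Z3)) *: conj_basis k)); last first.
  by move=> k _; rewrite -scalerDl /dzonal -/Z -/Z3; congr (_ *: _); ring.
rewrite big_split /= (bigD1 ord0) //= mulr1 big1 ?addr0; last first.
  by move=> k /negPf ->; rewrite mulr0 mul0r scale0r.
rewrite {1}/conj_basis unlift_none opprD addrA -scalerBl.
rewrite conj_zonalE /conj_comb scalerBr scalerA scaler_sumr -/Z -/Z3.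
congr (_ *: _ - _); first by ring.
by apply: eq_bigr => k _; rewrite scalerA.
Qed.

End CliffordLaplacian.

(** * The Clifford-Appell generating series *)

Section NegativeBinomial.
Context {R : realType}.

Lemma pochhammerS (a : R) s : pochhammer a s.+1 = pochhammer a s * (a + s%:R).
Proof. exact: big_ord_recr. Qed.

Lemma pochhammerSl (a : R) s : pochhammer a s.+1 = a * pochhammer (a + 1) s.
Proof.
rewrite /pochhammer big_ord_recl addr0; congr (_ * _).
by apply: eq_bigr => i _; rewrite -addrA nat1r.
Qed.

(* The coefficients of [(1 - z) ^- p]. *)
Definition negbin p a : R := pochhammer p%:R a / a`!%:R.

Lemma negbin0r p : negbin p 0 = 1.
Proof. by rewrite /negbin /pochhammer big_ord0 fact0 divr1. Qed.

Lemma negbin0l a : negbin 0 a = (a == 0%N)%:R.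
Proof.
by case: a => [|a]; rewrite ?negbin0r // /negbin pochhammerSl !mul0r.
Qed.

(** Coefficient form of [(1 - z) (1 - z) ^- (p + 1) = (1 - z) ^- p]. *)
Lemma negbinSS p a : negbin p.+1 a.+1 = negbin p a.+1 + negbin p.+1 a.
Proof.
rewrite /negbin [pochhammer p%:R _]pochhammerSl natr1 pochhammerS factS natrM.
have a1 : (a.+1%:R : R) != 0 by rewrite pnatr_eq0.
have af : (a`!%:R : R) != 0 by rewrite pnatr_eq0 -lt0n fact_gt0.
by rewrite -!natr1 in a1 *; field; rewrite a1 af.
Qed.

Lemma pochhammer_fact m k :
  pochhammer (m.+1%:R : R) k = (k + m)`!%:R / m`!%:R.
Proof.
have mf : (m`!%:R : R) != 0 by rewrite pnatr_eq0 -lt0n fact_gt0.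
elim: k => [|k IHk]; first by rewrite /pochhammer big_ord0 add0n divff.
by rewrite pochhammerS IHk addSn factS natrM -natrD addSn [(m + k)%N]addnC; field.
Qed.

End NegativeBinomial.

(** * Linear factors of generating series over an algebra *)

Section LinearFactors.
Context {R : realType} {A : algType R}.
Implicit Types (c x y : A) (F G : nat -> A).

(** Left multiplication by [1 - c z]. *)
Definition lin_mul c F k : A := F k - c * rshift_seq 1 F k.

Lemma lin_mul0 c F : lin_mul c F 0 = F 0%N.
Proof. by rewrite /lin_mul rshift_seq_lt // mulr0 subr0. Qed.

Lemma lin_mulS c F k : lin_mul c F k.+1 = F k.+1 - c * F k.
Proof. by rewrite /lin_mul [rshift_seq 1 F _](rshift_seq_add 1). Qed.

(** The constant term [1] lets coefficients be recovered one by one; identities between inverse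
    powers are proved below by clearing denominators this way. *)
Lemma lin_mul_inj c F G : lin_mul c F =1 lin_mul c G -> F =1 G.
Proof.
move=> FG; elim=> [|k IHk]; first by have := FG 0%N; rewrite !lin_mul0.
by have := FG k.+1; rewrite !lin_mulS IHk => /addIr.
Qed.

Variables (x y : A).
Hypothesis xyC : GRing.comm x y.

(** Coefficients of [(1 - x z) ^- p (1 - y z) ^- q]. *)
Definition bihom p q k : A := \sum_(s < k.+1)
  (negbin p (k - s) * negbin q s) *: (x ^+ (k - s) * y ^+ s).

Lemma lin_mul_bihoml p q : lin_mul x (bihom p.+1 q) =1 bihom p q.
Proof.
case=> [|k]; first by rewrite lin_mul0 /bihom !big_ord1 !negbin0r.
rewrite lin_mulS /bihom big_ord_recr [in RHS]big_ord_recr /= subnn !negbin0r.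
rewrite addrAC; congr (_ + _); rewrite mulr_sumr -sumrB; apply: eq_bigr => s _ /=.
have sk : (s <= k)%N by rewrite -ltnS.
rewrite subSn // negbinSS.
move: (negbin p _) (negbin p.+1 _) (negbin q _) => a b c.
rewrite -[x * (_ *: _)]scalerAr exprS -[x * _ * _]mulrA -scalerBl; congr (_ *: _).
by rewrite mulrDl addrK.
Qed.

Lemma lin_mul_bihomr p q : lin_mul y (bihom p q.+1) =1 bihom p q.
Proof.
case=> [|k]; first by rewrite lin_mul0 /bihom !big_ord1 !negbin0r.
rewrite lin_mulS /bihom big_ord_recl [in RHS]big_ord_recl /= !negbin0r.
rewrite -addrA; congr (_ + _); rewrite mulr_sumr -sumrB; apply: eq_bigr => s _ /=.
rewrite /bump /= add1n subSS negbinSS.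
move: (negbin q _) (negbin q.+1 _) (negbin p _) => a b c.
rewrite -[y * (_ *: _)]scalerAr [y * _]mulrA (commrX _ (commr_sym xyC)).
rewrite -[_ * y * _]mulrA -exprS -scalerBl; congr (_ *: _).
by rewrite mulrDr addrK.
Qed.

Variables (u w : R).
Hypotheses (xyD : x + y = u%:A) (xyM : x * y = w%:A).

Lemma lin_mul2 F k : lin_mul x (lin_mul y F) k =
  F k - u *: rshift_seq 1 F k + w *: rshift_seq 2 F k.
Proof.
have r : rshift_seq 1 (lin_mul y F) k = rshift_seq 1 F k - y * rshift_seq 2 F k.
  rewrite -[2%N]/(1 + 1)%N -rshift_seqD /rshift_seq; case: ifP => // _.
  by rewrite mulr0 subr0.
rewrite {1}/lin_mul r {1}/lin_mul mulrBr mulrA xyM.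
rewrite -[u *: rshift_seq _ _ _]mulr_algl -[w *: rshift_seq _ _ _]mulr_algl.
rewrite -xyD mulrDl opprB opprD.
by rewrite -!addrA; congr (_ + _); rewrite [X in _ + X = _]addrC addrCA.
Qed.

(** Coefficients of [(1 - y z) D ^- l], where [D = (1 - x z) (1 - y z) = 1 - u z + w z ^ 2]. *)
Definition gegenbauer_lin l k : A :=
  gegenbauer u w l k *: 1 - rshift_seq 1 (gegenbauer u w l) k *: y.

Lemma gegenbauer_linS l :
  lin_mul x (lin_mul y (gegenbauer_lin l.+1)) =1 gegenbauer_lin l.
Proof.
move=> k; rewrite lin_mul2.
have r j : rshift_seq j (gegenbauer_lin l.+1) k =
    rshift_seq j (gegenbauer u w l.+1) k *: 1
    - rshift_seq j.+1 (gegenbauer u w l.+1) k *: y.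
  rewrite -[j.+1]addn1 -rshift_seqD /rshift_seq /gegenbauer_lin; case: ifP => // _.
  by rewrite !scale0r subr0.
rewrite !r -[X in X - _ + _]/(gegenbauer_lin l.+1 k) /gegenbauer_lin.
rewrite (gegenbauerS u w l) (rshift_gegenbauerS 1 u w l).
rewrite !scalerBr !scalerA !(scalerDl, scaleNr) opprB.
rewrite [X in _ + X + _ = _]addrC [X in X + _ = _]addrACA [LHS]addrACA.
by rewrite !opprD opprK.
Qed.

(** Multiplied by [D], both generating series become [1 - y z]. *)
Lemma gegenbauer_lin_pow k : gegenbauer_lin 1 k = x ^+ k.
Proof.
suff h : lin_mul x (lin_mul y (fun k => x ^+ k)) =1
    lin_mul x (lin_mul y (gegenbauer_lin 1)).
  exact/esym/(lin_mul_inj (lin_mul_inj h)).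
move=> {}k; rewrite gegenbauer_linS lin_mul2 /gegenbauer_lin /gegenbauer /=.
case: k => [|[|k]].
- by rewrite !rshift_seq_lt // !scaler0 subr0 addr0 scale0r subr0 scale1r.
- rewrite [rshift_seq 2 _ _]rshift_seq_lt // scaler0 addr0 expr1.
  rewrite ![rshift_seq 1 _ 1](rshift_seq_add 1) /= scale0r sub0r scale1r.
  by rewrite expr0 -xyD opprD addNKr.
- rewrite ![rshift_seq 1 _ _](rshift_seq_add 1) [rshift_seq 2 _ _](rshift_seq_add 2).
  rewrite /= !scale0r subr0 -mulr_algl -(mulr_algl w) -xyD -xyM.
  rewrite !exprS mulrDl opprD addrA subrr sub0r -[x * y * _]mulrA [y * (x * _)]mulrA.
  by rewrite -xyC -mulrA addNr.
Qed.

(** Multiplication by [(1 - x z) (1 - y z)] lowers [l] by one on both sides, which gives the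
    induction. *)
Lemma gegenbauer_lin_bihom l : gegenbauer_lin l.+1 =1 bihom l.+1 l.
Proof.
elim: l => [|l IHl].
  move=> k; rewrite gegenbauer_lin_pow; move: k; apply: (@lin_mul_inj x) => k.
  rewrite lin_mul_bihoml; case: k => [|k].
    by rewrite lin_mul0 /bihom big_ord1 !negbin0r mulr1 scale1r expr0 mulr1.
  rewrite lin_mulS exprS subrr /bihom big1 // => s _; rewrite !negbin0l.
  case: (s : nat) => [|s']; first by rewrite mul0r scale0r.
  by rewrite mulr0 scale0r.
apply: (@lin_mul_inj y); apply: (@lin_mul_inj x) => k.
rewrite gegenbauer_linS IHl -lin_mul_bihoml; move: k.
suff -> : lin_mul y (bihom l.+2 l.+1) = bihom l.+2 l by [].
by apply/funext => k; exact: lin_mul_bihomr.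
Qed.

End LinearFactors.

(** * A paravector and its conjugate as commuting roots of a real quadratic *)

Section Paravector.
Context {R : realType} {n : nat}.
Implicit Types x : 'rV[R]_n.+1.

(** Adding the double sum to its transpose produces the anticommutators, which vanish off the
    diagonal. *)
Lemma sqr_cliff_vector (v : 'I_n -> R) :
  (\sum_l v l *: cliff_gen l) * (\sum_l v l *: cliff_gen l)
  = - (\sum_l v l ^+ 2)%:A :> clifford R n.
Proof.
set V := \sum_l _.
have VV : V * V = \sum_i \sum_j (v i * v j) *: (cliff_gen i * cliff_gen j).
  rewrite {1}/V mulr_suml; apply: eq_bigr => i _.
  rewrite /V mulr_sumr; apply: eq_bigr => j _.
  by rewrite -scalerAl -scalerAr scalerA.
suff : V * V + V * V = - (\sum_l v l ^+ 2)%:A + - (\sum_l v l ^+ 2)%:A.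
  move=> h; apply: (@scalerI R _ 2); first by rewrite pnatr_eq0.
  by rewrite !scaler_nat !mulr2n.
rewrite {1}VV VV [X in _ + X]exchange_big /= -big_split /=.
rewrite scaler_suml -sumrN -big_split /=; apply: eq_bigr => i _.
rewrite -big_split (bigD1 i) //= big1 ?addr0 => [|j ji].
  by rewrite cliff_gen_sqr scalerN.
by rewrite [v j * v i]mulrC -scalerDr cliff_gen_anticomm ?scaler0 // eq_sym.
Qed.

Lemma paravectorD x :
  paravector x + paravector_conj x = (2 * x ord0 ord0)%:A :> clifford R n.
Proof.
by rewrite /paravector /paravector_conj addrACA subrr addr0 -scalerDl mulr_natl mulr2n.
Qed.

Lemma paravectorM x :
  paravector x * paravector_conj x = (sqnorm x)%:A :> clifford R n.
Proof.
rewrite /paravector /paravector_conj; set V := \sum_l _.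
rewrite mulrBr !mulrDl mulr_algl [V * _]mulr_algr [_%:A * V]mulr_algl.
rewrite opprD addrA addrK sqr_cliff_vector opprK scalerA -scalerDl.
by rewrite /sqnorm big_ord_recl expr2.
Qed.

Lemma paravectorC x : GRing.comm (paravector x) (paravector_conj x : clifford R n).
Proof.
have -> : paravector_conj x = (2 * x ord0 ord0)%:A - paravector x :> clifford R n.
  by rewrite -paravectorD addrC addKr.
by apply: commrB; [exact: commr_sym (comm_alg _ _) | exact: commr_refl].
Qed.

Lemma cvg_conj_zonal l (d : nat -> R) x : entire d ->
  series (fun k => d k *: gegenbauer_lin (paravector_conj x : clifford R n)
     (2 * x ord0 ord0) (sqnorm x) l k) @ \oo --> conj_zonal l d x.
Proof.
move=> ed.
have c0 := @pairable_gegenbauer _ l d (2 * x ord0 ord0) (sqnorm x) ed.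
have [c1 e1] := @pairing_rshift1_gegenbauer _ l d (2 * x ord0 ord0) (sqnorm x) ed.
pose g := gegenbauer (2 * x ord0 ord0) (sqnorm x) l.
rewrite (_ : series _ = fun k => series (fun k => d k * g k) k *: (1 : clifford R n)
   - series (fun k => d k * rshift_seq 1 g k) k *: (paravector_conj x : clifford R n)).
  by apply: cvgB; apply: cvgZr_tmp; rewrite ?/zonal -?e1.
apply/funext => k; rewrite /series /= !scaler_suml -sumrB; apply: eq_bigr => i _.
by rewrite scalerBr !scalerA.
Qed.

Lemma cvg_conj_zonal1 (d : nat -> R) x : entire d ->
  series (fun k => d k *: (paravector x : clifford R n) ^+ k) @ \oo -->
  conj_zonal 1 d x.
Proof.
move=> ed.
rewrite (_ : (fun k => _) = (fun k => d k *: gegenbauer_lin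
    (paravector_conj x : clifford R n) (2 * x ord0 ord0) (sqnorm x) 1 k)).
  exact: cvg_conj_zonal.
apply/funext => k; congr (_ *: _); apply/esym.
exact: gegenbauer_lin_pow (paravectorC x) _ _ (paravectorD x) (paravectorM x) k.
Qed.

End Paravector.

(** * Iterates of the Laplacian *)

Section IteratedLaplacian.
Context {R : realType} {n : nat}.
Implicit Types (d : nat -> R) (j m : nat).

(** Product of the factors of [laplacian_conj_zonal] for [l = 1, ..., j]. *)
Definition laplacian_coef j : R :=
  \prod_(i < j) (2 * i.+1%:R * (2 * i.+1%:R - 1 - n%:R)).

Lemma entire_shiftn j d : entire d -> entire (fun k => d (k + j)%N).
Proof.
elim: j => [|j IHj] ed; first by under eq_fun do rewrite addn0.
have -> : (fun k => d (k + j.+1)%N) = (fun k => d (k + j)%N) \o succn.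
  by apply/funext => k; rewrite /= addnS.
by apply: entire_shift; exact: IHj.
Qed.

Lemma laplacianZ (c : R) (f : 'rV[R]_n.+1 -> clifford R n) :
  (forall x i, derivable f x (delta_mx ord0 i) /\
    derivable ('D_(delta_mx ord0 i) f) x (delta_mx ord0 i)) ->
  (forall x i, derivable (c \*: f) x (delta_mx ord0 i) /\
    derivable ('D_(delta_mx ord0 i) (c \*: f)) x (delta_mx ord0 i)) /\
  laplacian (c \*: f) = c \*: laplacian f.
Proof.
move=> df.
have DZ i : 'D_(delta_mx ord0 i) (c \*: f) = c \*: 'D_(delta_mx ord0 i) f.
  by apply/funext => x; apply: deriveZ; case: (df x i).
split=> [x i|].
  rewrite DZ; case: (df x i) => ? ?; split; exact: derivableZ.
apply/funext => x; rewrite /laplacian /= scaler_sumr; apply: eq_bigr => i _.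
by rewrite DZ deriveZ //; case: (df x i).
Qed.

Lemma iter_laplacian_conj_zonal j d : entire d ->
  iter j laplacian (conj_zonal 1 d : 'rV[R]_n.+1 -> clifford R n) =
  laplacian_coef j \*: conj_zonal j.+1 (fun k => d (k + j.*2)%N).
Proof.
move=> ed; elim: j => [|j IHj].
  have -> : (fun k => d (k + 0.*2)%N) = d by apply/funext => k; rewrite addn0.
  by rewrite /laplacian_coef big_ord0; apply/funext => x /=; rewrite scale1r.
have [dz lz] := laplacian_conj_zonal (n := n) j.+1 (@entire_shiftn j.*2 d ed).
rewrite iterS IHj (laplacianZ _ dz).2 lz; apply/funext => x /=.
rewrite scalerA /laplacian_coef big_ord_recr /=.
rewrite (_ : _ \o _ \o _ = fun k => d (k + j.+1.*2)%N) //.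
by apply/funext => k /=; rewrite doubleS !addSn !addnS.
Qed.

Lemma iter_laplacian_exists_conj_zonal m d : entire d ->
  iter_laplacian_exists m (conj_zonal 1 d : 'rV[R]_n.+1 -> clifford R n).
Proof.
move=> ed j i x _ /=; rewrite iter_laplacian_conj_zonal //.
have [dz _] := laplacian_conj_zonal (n := n) j.+1 (@entire_shiftn j.*2 d ed).
exact: (laplacianZ _ dz).1.
Qed.

End IteratedLaplacian.

(** * Clifford-Appell series for odd [n] *)

Section AppellSeries.
Context {R : realType} (m : nat).
Let n := m.*2.+1.
Implicit Types (x : 'rV[R]_n.+1) (a : nat -> R).

(** For [n = 2 m + 1] the factor of index [i] is [- 4 (i + 1) (m - i)]. *)
Lemma laplacian_coefE :
  laplacian_coef (n := n) m = (-1) ^+ m * 2 ^+ m.*2 * m`!%:R ^+ 2 :> R.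
Proof.
have -> : laplacian_coef (n := n) m = \prod_(i < m) ((-4) * i.+1%:R * (m - i)%:R) :> R.
  apply: eq_bigr => i _; rewrite natrB; last exact: ltnW.
  by rewrite -[n%:R]natr1 -[m.*2]muln2 natrM -natr1; ring.
rewrite !big_split /= prodr_const card_ord.
have mE : \prod_(i < m) i.+1%:R = m`!%:R :> R.
  by rewrite fact_prod natr_prod big_add1 big_mkord.
have -> : \prod_(i < m) (m - i)%:R = m`!%:R :> R.
  rewrite -mE (reindex_inj rev_ord_inj) /=; apply: eq_bigr => i _.
  by rewrite subKn.
rewrite mE -[_.*2]mul2n exprM -exprMn mulrA expr2 !mulrA.
by congr (_ ^+ _ * _ * _); ring.
Qed.

(** Here [(n + 1) / 2 = m + 1], [(n - 1) / 2 = m] and [(n)_k = (k + 2 m)! / (2 m)!], so the binomial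
    coefficient splits the Pochhammer symbols into two [negbin] factors. *)
Lemma appellE k x : appell k x =
  (k`!%:R * (m.*2)`!%:R / (k + m.*2)`!%:R) *:
  bihom (paravector x) (paravector_conj x : clifford R n) m.+1 m k.
Proof.
rewrite /appell /bihom scaler_sumr; apply: eq_bigr => s _.
rewrite scalerA; congr (_ *: _).
have fn0 j : (j`!%:R : R) != 0 by rewrite pnatr_eq0 -lt0n fact_gt0.
have sk : (s <= k)%N by rewrite -ltnS.
rewrite /appell_coef.
have -> : n.+1%:R / 2 = m.+1%:R :> R.
  by rewrite /n -doubleS -muln2 natrM mulfK.
have -> : (n%:R - 1) / 2 = m%:R :> R.
  by rewrite /n -natr1 addrK -muln2 natrM mulfK.
rewrite [pochhammer n%:R k]pochhammer_fact /negbin -(bin_fact sk) !natrM.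
by field; rewrite !fn0.
Qed.

(** [appellE] trades [k!] for [(k + 2 m)!], so the coefficients become the sequence [a k / k!]
    shifted by [2 m], as the iterated Laplacian leaves it. *)
Lemma cvg_appell a x : (forall k, `|a k| <= 1) ->
  series (fun k => (a (k + m.*2)%N / k`!%:R) *: appell k x) @ \oo -->
  (m.*2)`!%:R *: conj_zonal m.+1 (fun k => a (k + m.*2)%N / (k + m.*2)`!%:R) x.
Proof.
move=> a1.
have ed : entire (fun k => a (k + m.*2)%N / (k + m.*2)`!%:R).
  apply: (@entire_shiftn _ m.*2 (fun k => a k / k`!%:R)).
  apply: entire_fact => k; rewrite normrM normfV normr_nat.
  by rewrite ler_piMl // invr_ge0.
have fn0 j : (j`!%:R : R) != 0 by rewrite pnatr_eq0 -lt0n fact_gt0.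
rewrite (_ : series _ = fun k => (m.*2)`!%:R *: series (fun k =>
  (a (k + m.*2)%N / (k + m.*2)`!%:R) *: gegenbauer_lin
    (paravector_conj x : clifford R n) (2 * x ord0 ord0) (sqnorm x) m.+1 k) k).
  by apply: cvgZl_tmp; exact: cvg_conj_zonal.
apply/funext => k; rewrite /series /= scaler_sumr; apply: eq_bigr => i _.
rewrite (gegenbauer_lin_bihom (paravectorC x) (paravectorD x) (paravectorM x)).
by rewrite appellE !scalerA; congr (_ *: _); field; rewrite !fn0.
Qed.

End AppellSeries.

(** * Series supported on one parity *)

Section Parity.
Context {R : realType} {V : normedModType R}.

(** For either parity, the first [k] kept terms have the same sum as the first [2 k] terms of
    [u]. *)
Lemma cvg_series_parity (b : bool) (u : nat -> V) (l : V) :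
  (forall k, odd k = ~~ b -> u k = 0) -> series u @ \oo --> l ->
  series (fun k => u (b + k.*2)%N) @ \oo --> l.
Proof.
move=> ub ul.
have -> : series (fun k => u (b + k.*2)%N) = series u \o double.
  apply/funext; elim=> [|k IHk]; first by rewrite /series /= !big_geq.
  rewrite seriesSr IHk /= doubleS !seriesSr -addrA; congr (_ + _).
  case: b {IHk} ub => ub.
    by rewrite (ub k.*2) ?add0r // odd_double.
  by rewrite (ub k.*2.+1) ?addr0 //= odd_double.
apply: cvg_comp ul; apply/cvgnyPge => A; near=> k.
apply: (@leq_trans k); first by near: k; exact: nbhs_infty_ge.
by rewrite -addnn leq_addr.
Unshelve. all: by end_near. Qed.

End Parity.

(** * The Gamma function at positive integers *)

Section GammaNat.
Context {R : realType}.
Implicit Types (m : nat) (t : R).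

(** Antiderivative of [t ^ m * expR (- t)] obtained by repeated integration by parts. *)
Fixpoint gamma_primitive m t : R :=
  if m is m'.+1 then m%:R * gamma_primitive m' t - t ^+ m * expR (- t)
  else - expR (- t).

Lemma is_derive_expRN t : is_derive t 1 (fun s : R => expR (- s)) (- expR (- t)).
Proof.
have h := is_derive1_comp (is_derive_expR (- t)) (is_deriveNid t 1).
by apply: is_derive_eq h _; rewrite mulrN1.
Qed.

Lemma is_derive_gamma_primitive m t :
  is_derive t 1 (gamma_primitive m) (t ^+ m * expR (- t)).
Proof.
elim: m => [|m IHm].
  by rewrite expr0 mul1r -[expR _]opprK; apply: is_deriveN (is_derive_expRN t).
have h1 := is_deriveZ m.+1%:R IHm.
have h2 := is_deriveM (is_deriveX m.+1 (is_derive_id t 1)) (is_derive_expRN t).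
rewrite (_ : gamma_primitive m.+1 = m.+1%:R *: gamma_primitive m
  - (id ^+ m.+1) * (fun s => expR (- s))); last first.
  by apply/funext => s /=; rewrite !fctE.
apply: (is_derive_eq (is_deriveB h1 h2)).
rewrite -![_ *: _]/(_ * _) exprfctE /= exprS; ring.
Qed.

(** From [t ^ (m + 1) / (m + 1)! <= expR t], the function is at most [(m + 1)! / t] for [t > 0]. *)
Lemma cvgr_expn_expRN m : t ^+ m * @expR R (- t) @[t --> +oo] --> 0.
Proof.
have h : (m.+1)`!%:R * t^-1 @[t --> +oo%R] --> (0 : R).
  rewrite -[0](mulr0 (m.+1)`!%:R); apply: cvgMl_tmp.
  apply/(gtr0_cvgV0 (f := id)) => //; exact: nbhs_pinfty_gt.
apply: (@squeeze_cvgr _ _ _ _ (fun=> 0) (fun t => (m.+1)`!%:R * t^-1)) => //.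
  near=> t.
  have t0 : 0 < t by near: t; exact: nbhs_pinfty_gt.
  rewrite mulr_ge0 ?exprn_ge0 ?expR_ge0 ?(ltW t0) //=.
  rewrite expRN ler_pdivrMr ?expR_gt0 // mulrAC ler_pdivlMr //.
  rewrite -exprSr mulrC -ler_pdivrMr ?ltr0n ?fact_gt0 //.
  by rewrite (le_trans _ (expR_ge1Dxn m (ltW t0))) // lerDr.
exact: cvg_cst.
Unshelve. all: by end_near. Qed.

Lemma cvgr_gamma_primitive m : gamma_primitive m t @[t --> +oo] --> 0.
Proof.
elim: m => [|m IHm] /=.
  by rewrite -oppr0; apply: cvgN; exact: cvgr_expR.
rewrite -[0]subr0 -{1}[0](mulr0 m.+1%:R); apply: cvgB; last exact: cvgr_expn_expRN.
by apply: cvgMl_tmp.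
Qed.

Lemma gamma_primitive0 m : gamma_primitive m 0 = - m`!%:R :> R.
Proof.
elim: m => [|m IHm] /=; first by rewrite oppr0 expR0.
by rewrite IHm expr0n mul0r subr0 factS natrM mulrN.
Qed.

Lemma Gamma_nat m : Gamma (m.+1%:R : R) = m`!%:R.
Proof.
have cf : continuous (fun t : R => t ^+ m * expR (- t)).
  move=> t; apply: cvgM; first exact: exprn_continuous.
  by apply: continuous_comp; [exact: opp_continuous | exact: continuous_expR].
rewrite /Gamma.
transitivity (Rintegral lebesgue_measure `]0, +oo[ (fun t : R => t ^+ m * expR (- t))).
  apply: eq_Rintegral => t; rewrite inE /= in_itv /= andbT => t0.
  by rewrite -natr1 addrK powR_mulrn // ltW.
(* The null set [{0}] is added to integrate over a closed half-line. *)
rewrite /Rintegral integral_itv_obnd_cbnd; last first.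
  apply/measurable_EFinP; apply: measurable_funTS.
  exact: continuous_measurable_fun.
rewrite -/(Rintegral _ _ _).
rewrite (@Rintegral_ge0_continuous_FTC2y _ _ (gamma_primitive m) 0 0).
- by rewrite gamma_primitive0 sub0r opprK.
- by move=> t t0; rewrite mulr_ge0 ?exprn_ge0 ?expR_ge0.
- exact: continuous_subspaceT.
- exact: cvgr_gamma_primitive.
- by move=> t _; case: (is_derive_gamma_primitive m t).
- apply: cvg_at_right_filter.
  apply: differentiable_continuous; apply/derivable1_diffP.
  by case: (is_derive_gamma_primitive m 0).
- by move=> t _; rewrite derive1E; case: (is_derive_gamma_primitive m t).
Qed.

End GammaNat.

(** * The iterated Laplacian of a power series *)

Section LaplacianOfPowerSeries.
Context {R : realType} (m : nat).
Let n := m.*2.+1.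
Implicit Types (x : 'rV[R]_n.+1) (a : nat -> R) (s : R).

Lemma gamma_constE : gamma_const n = laplacian_coef (n := n) m / (m.*2)`!%:R :> R.
Proof.
rewrite /gamma_const laplacian_coefE.
have -> : n.+1%:R / 2 = m.+1%:R :> R by rewrite /n -doubleS -muln2 natrM mulfK.
by rewrite Gamma_nat /n /= doubleK mulrAC.
Qed.

(** Common form of the five cases: [e] enumerates the exponents, [t] their coefficients, and [s] is
    a sign. *)
Definition appell_transform s (e : nat -> nat) (t : nat -> R) : Prop :=
  let f x : clifford R n := lim (series (fun k => t k *: paravector x ^+ e k) @ \oo) in
  iter_laplacian_exists m f /\
  forall x, cvg (series (fun k => t k *: appell (e k) x) @ \oo) /\
    iter m laplacian f x =
      (s * gamma_const n) *: lim (series (fun k => t k *: appell (e k) x) @ \oo).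

(* [s] is the effect on [a] of the index shift by [2 m] in [cvg_appell]. *)
Lemma appell_transform_series a s e : (forall k, `|a k| <= 1) -> s * s = 1 ->
  (forall k, a (k + m.*2)%N = s * a k) ->
  (forall (u : nat -> clifford R n) (l : clifford R n), (forall k, a k = 0 -> u k = 0) ->
    series u @ \oo --> l -> series (u \o e) @ \oo --> l) ->
  appell_transform s e (fun k => a (e k) / (e k)`!%:R).
Proof.
move=> a1 ss aS ae.
have ed : entire (fun k => a k / k`!%:R).
  apply: entire_fact => k; rewrite normrM normfV normr_nat.
  by rewrite ler_piMl // invr_ge0.
(* Reindexing by [e] drops only terms where [a] vanishes, so this is the full power series with
   coefficients [a k / k!]. *)
have fE : (fun x : 'rV[R]_n.+1 => lim (series (fun k =>
     (a (e k) / (e k)`!%:R) *: (paravector x : clifford R n) ^+ e k) @ \oo))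
   = conj_zonal 1 (fun k => a k / k`!%:R).
  apply/funext => x; apply: cvg_lim => //.
  apply: (ae (fun k => (a k / k`!%:R) *: (paravector x : clifford R n) ^+ k)).
    by move=> k ->; rewrite mul0r scale0r.
  exact: cvg_conj_zonal1.
rewrite /appell_transform fE; split; first exact: iter_laplacian_exists_conj_zonal.
move=> x.
set Z := conj_zonal m.+1 (fun k => a (k + m.*2)%N / (k + m.*2)`!%:R) x.
have cP : series (fun k => (a (e k) / (e k)`!%:R) *: appell (e k) x)
    @ \oo --> s *: ((m.*2)`!%:R *: Z).
  apply: (ae (fun k => (a k / k`!%:R) *: appell k x)).
    by move=> k ->; rewrite mul0r scale0r.
  (* Since [s * s = 1], [a k = s * a (k + 2 m)]. *)
  rewrite (_ : series _ = fun k => s *: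
      series (fun k => (a (k + m.*2)%N / k`!%:R) *: appell k x) k).
    by apply: cvgZl_tmp; exact: cvg_appell.
  apply/funext => k; rewrite /series /= scaler_sumr; apply: eq_bigr => i _.
  by rewrite scalerA aS !mulrA ss mul1r.
split; first by apply/cvg_ex; eexists; exact: cP.
rewrite (cvg_lim _ cP) // iter_laplacian_conj_zonal // !scalerA gamma_constE.
have fn0 : ((m.*2)`!%:R : R) != 0 by rewrite pnatr_eq0 -lt0n fact_gt0.
have -> : s * (laplacian_coef (n := n) m / (m.*2)`!%:R) * s * (m.*2)`!%:R
    = s * s * laplacian_coef (n := n) m by field.
by rewrite ss mul1r.
Qed.

Lemma appell_transform_exp : appell_transform 1 id (fun k => k`!%:R^-1).
Proof.
rewrite (_ : (fun k => _) = (fun k => 1 / k`!%:R)); last first.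
  by apply/funext => k; rewrite div1r.
apply: (appell_transform_series (a := fun=> 1) (e := id)) => // [k||k].
- by rewrite normr1.
- by rewrite mulr1.
- by rewrite mulr1.
Qed.

(** With [a k = r ^ (k / 2)] (integer division) on the indices of parity [b] and [0] elsewhere, a
    shift by [2 m] multiplies [a] by [r ^ m]. Hyperbolic functions have [r = 1], trigonometric ones
    [r = -1]. *)
Lemma appell_transform_parity (r : R) (b : bool) : r * r = 1 ->
  appell_transform (r ^+ m) (fun k => b + k.*2)%N
    (fun k => r ^+ k / (b + k.*2)`!%:R).
Proof.
move=> rr; pose a k : R := (odd k == b)%:R * r ^+ k./2.
have aE k : a (b + k.*2)%N = r ^+ k.
  by rewrite /a oddD odd_double addbF oddb eqxx mul1r half_bit_double.
rewrite (_ : (fun k => _ / _) = (fun k => a (b + k.*2)%N / (b + k.*2)`!%:R)); last first.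
  by apply/funext => k; rewrite aE.
apply: (appell_transform_series (a := a) (e := fun k => (b + k.*2)%N)).
- move=> k; rewrite normrM normrX.
  have /eqP : `|r| ^+ 2 = 1 by rewrite -normrX expr2 rr normr1.
  rewrite sqrp_eq1 // => /eqP ->; rewrite expr1n mulr1.
  by case: (_ == _); rewrite ?normr1 ?normr0.
- by rewrite -exprMn rr expr1n.
- move=> k; rewrite /a oddD odd_double addbF halfD odd_double andbF doubleK.
  by rewrite add0n exprD mulrA mulrC.
- move=> u l au; apply: cvg_series_parity => k kb; apply: au.
  by rewrite /a kb; case: (b); rewrite mul0r.
Qed.

Lemma appell_transform_hyperbolic (b : bool) :
  appell_transform 1 (fun k => b + k.*2)%N (fun k => (b + k.*2)`!%:R^-1).
Proof.
rewrite -[X in appell_transform X](expr1n R m).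
rewrite (_ : (fun k => _) = (fun k => 1 ^+ k / (b + k.*2)`!%:R)).
  by apply: appell_transform_parity; rewrite mulr1.
by apply/funext => k; rewrite expr1n div1r.
Qed.

End LaplacianOfPowerSeries.

Unset Implicit Arguments.

Theorem theorem3p8 (R : realType) (n : nat) (n_odd : odd n) :
  let m := n.-1./2 in
  let exp_term (x : 'rV[R]_n.+1) (k : nat) :=
    (k`!%:R^-1 : R) *: appell k x in
  let sinh_term (x : 'rV[R]_n.+1) (k : nat) :=
    ((k.*2.+1)`!%:R^-1 : R) *: appell k.*2.+1 x in
  let cosh_term (x : 'rV[R]_n.+1) (k : nat) :=
    ((k.*2)`!%:R^-1 : R) *: appell k.*2 x in
  let cos_term (x : 'rV[R]_n.+1) (k : nat) :=
    ((-1) ^+ k / (k.*2)`!%:R : R) *: appell k.*2 x in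
  let sin_term (x : 'rV[R]_n.+1) (k : nat) :=
    ((-1) ^+ k / (k.*2.+1)`!%:R : R) *: appell k.*2.+1 x in
  [/\ iter_laplacian_exists m (@cliff_exp R n),
      iter_laplacian_exists m (@cliff_sinh R n),
      iter_laplacian_exists m (@cliff_cosh R n),
      iter_laplacian_exists m (@cliff_cos R n) &
      iter_laplacian_exists m (@cliff_sin R n)] /\
  forall x : 'rV[R]_n.+1,
  [/\ cvg (series (exp_term x) @ \oo),
      cvg (series (sinh_term x) @ \oo),
      cvg (series (cosh_term x) @ \oo),
      cvg (series (cos_term x) @ \oo) &
      cvg (series (sin_term x) @ \oo)] /\
  [/\ iter m laplacian cliff_exp x
        = gamma_const n *: lim (series (exp_term x) @ \oo),
      iter m laplacian cliff_sinh x
        = gamma_const n *: lim (series (sinh_term x) @ \oo),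
      iter m laplacian cliff_cosh x
        = gamma_const n *: lim (series (cosh_term x) @ \oo),
      iter m laplacian cliff_cos x
        = ((-1) ^+ m * gamma_const n) *: lim (series (cos_term x) @ \oo) &
      iter m laplacian cliff_sin x
        = ((-1) ^+ m * gamma_const n) *: lim (series (sin_term x) @ \oo)].
Proof.
have [m ->] : exists m, n = m.*2.+1.
  by exists n./2; rewrite -[LHS]odd_double_half n_odd.
rewrite /= doubleK => {n n_odd}.
have N1 : (-1 : R) * -1 = 1 by rewrite mulrNN mulr1.
have [Eexp Hexp] := @appell_transform_exp R m.
(* [true] selects the odd exponents and [false] the even ones. *)
have [Esinh Hsinh] := @appell_transform_hyperbolic R m true.
have [Ecosh Hcosh] := @appell_transform_hyperbolic R m false.
have [Ecos Hcos] := @appell_transform_parity R m (-1) false N1.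
have [Esin Hsin] := @appell_transform_parity R m (-1) true N1.
split=> [|x].
  by split; [exact: Eexp|exact: Esinh|exact: Ecosh|exact: Ecos|exact: Esin].
have [Cexp] := Hexp x; have [Csinh] := Hsinh x; have [Ccosh] := Hcosh x.
have [Ccos Lcos] := Hcos x; have [Csin Lsin] := Hsin x.
rewrite mul1r => Lcosh Lsinh Lexp.
split; first by split; [exact: Cexp|exact: Csinh|exact: Ccosh|exact: Ccos|exact: Csin].
by split; [exact: Lexp|exact: Lsinh|exact: Lcosh|exact: Lcos|exact: Lsin].
Qed.
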